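(* Let $R$ be a commutative Noetherian local ring. If $I_1\subseteq I_2$ are (proper) ideals of $R$ of the same grade, then $D(I_1)\subseteq D(I_2)$. In particular, for every (proper) ideal $I$, $$\bigcap_{m=1}^\infty D(I^m)\subseteq\cdots\subseteq D(I^{n+1})\subseteq D(I^n)\subseteq\cdots\subseteq D(I).$$
   Context: For a proper ideal $I$ of grade $g$, $D(I):=\mathrm{Ann}_R(\mathrm{Ext}^g_R(R/I,R))$. *)

(* Defs.v *)
From HB Require Import structures.
From mathcomp Require Import all_boot all_order all_algebra all_classical.
From mathcomp Require Import freeg.

Set Implicit Arguments.
Unset Strict Implicit.
Unset Printing Implicit Defensive.

Import GRing.Theory.

Local Open Scope quotient_scope.
Local Open Scope classical_set_scope.
Local Open Scope ring_scope.

Section SubQuotientModules.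
Variables (R : comNzRingType) (V : lmodType R) (U : submodClosed V).

Definition sub_lmod : Type := {x : V | x \in U}.
HB.instance Definition _ := SubChoice.on sub_lmod.
HB.instance Definition _ := [SubChoice_isSubLmodule of sub_lmod by <:].

(* submodClosed is stated for semimodules, so it does not contain closure     *)
(* under opposite, which quotients require.                                   *)
Definition submod_zmod : {pred V} := fun x => x \in U.

Lemma submod_zmod_closed : zmod_closed submod_zmod.
Proof.
split=> [|x y Ux Uy]; first exact: (rpred0 U).
by rewrite -scaleN1r; apply: (rpredD (S := U)); rewrite ?rpredZ.
Qed.
HB.instance Definition _ :=
  GRing.isZmodClosed.Build V submod_zmod submod_zmod_closed.

Definition quot_lmod : Type := Quotient.quot submod_zmod.
HB.instance Definition _ := GRing.Zmodule.on quot_lmod.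

Definition quot_scale (a : R) : quot_lmod -> quot_lmod :=
  lift_op1 (Quotient.quot submod_zmod) ( *:%R a).

Lemma pi_quot_scale a :
  {morph \pi_(Quotient.quot submod_zmod) : x / a *: x >-> quot_scale a x}.
Proof.
move=> x; unlock quot_scale; apply/eqP; rewrite piE Quotient.equivE.
rewrite -scalerBr; apply: (@rpredZ _ _ U a).
by rewrite -[_ \in _]/(_ \in submod_zmod) Quotient.idealrBE reprK.
Qed.
Canonical pi_quot_scale_morph a := PiMorph1 (pi_quot_scale a).

Lemma quot_scaleA a b v : quot_scale a (quot_scale b v) = quot_scale (a * b) v.
Proof. by rewrite -[v]reprK !piE scalerA. Qed.

Lemma quot_scale1 : left_id 1 quot_scale.
Proof. by move=> v; rewrite -[v]reprK !piE scale1r. Qed.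

Lemma quot_scaleDr : right_distributive quot_scale +%R.
Proof. by move=> a v w; rewrite -[v]reprK -[w]reprK !piE scalerDr. Qed.

Lemma quot_scaleDl v : {morph quot_scale^~ v : a b / a + b}.
Proof. by move=> a b; rewrite -[v]reprK !piE scalerDl. Qed.

HB.instance Definition _ := GRing.Zmodule_isLmodule.Build R quot_lmod
  quot_scaleA quot_scale1 quot_scaleDr quot_scaleDl.

End SubQuotientModules.

(* The ideals of the commutative ring R are the submodules of R^o. *)
Notation ideal R := (submodClosed R^o).

Section Ideals.
Variable R : comNzRingType.

Definition is_proper (I : ideal R) := (1 : R^o) \notin I.

Definition ideal_gen_pred (S : set R) : {pred R^o} :=
  fun x => `[< forall J : ideal R, S `<=` [set` J] -> x \in J >].

Lemma ideal_gen_closed S : GRing.submod_closed (ideal_gen_pred S).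
Proof.
split=> [|a x y /asboolP xS /asboolP yS]; apply/asboolP => J SJ.
  exact: rpred0.
by rewrite rpredD ?rpredZ ?xS ?yS.
Qed.
HB.instance Definition _ S :=
  GRing.isSubmodClosed.Build R R^o (ideal_gen_pred S) (ideal_gen_closed S).

Definition ideal_gen (S : set R) : ideal R := ideal_gen_pred S.

Definition ideal_mul (I J : ideal R) : ideal R :=
  ideal_gen [set x | exists a b : R^o, [/\ a \in I, b \in J & x = a * b]].

Fixpoint ideal_exp (I : ideal R) (n : nat) : ideal R :=
  if n is n'.+1 then ideal_mul I (ideal_exp I n') else ideal_gen setT.

Definition noetherian :=
  forall I : ideal R, exists s : seq R, I =i ideal_gen [set` s].

Definition maximal_ideal (I : ideal R) :=
  is_proper I /\ forall J : ideal R, {subset I <= J} -> is_proper J -> J =i I.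

Definition local_ring :=
  exists2 I : ideal R, maximal_ideal I &
    forall J : ideal R, maximal_ideal J -> J =i I.

(* Each s`_i is a nonzerodivisor on R / (s`_0, ..., s`_(i-1)), and the full   *)
(* quotient R / (s) is nonzero.                                               *)
Definition regular_seq (s : seq R) :=
  is_proper (ideal_gen [set` s]) /\
  forall i, (i < size s)%N -> forall a : R,
    s`_i * a \in ideal_gen [set` take i s] -> a \in ideal_gen [set` take i s].

Definition is_grade (I : ideal R) (g : nat) :=
  (exists s : seq R, [/\ all [in I] s, regular_seq s & size s = g]) /\
  (forall s : seq R, all [in I] s -> regular_seq s -> (size s <= g)%N).

(* Unspecified (0) only when I contains arbitrarily long regular sequences,   *)
(* which does not happen for a proper ideal of a noetherian ring.             *)
Definition grade (I : ideal R) : nat := xget 0%N [set g | is_grade I g].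

End Ideals.

(* The free module on the underlying set of M, and its map onto M.            *)
Section FreeCover.
Variables (R : comNzRingType) (M : lmodType R).

Definition free_cover : lmodType R := {freeg M / R}.

Definition cover_map : free_cover -> M := fglift id.

Lemma cover_map_is_linear : linear cover_map.
Proof.
pose fD := GRing.isZmodMorphism.Build free_cover M cover_map
  (@lift_is_additive R M M id).
pose f : {additive free_cover -> M} :=
  HB.pack_for {additive free_cover -> M} cover_map fD.
have fZ a (x : free_cover) : f (a *: x) = a *: f x.
  have -> : f (a *: x) = \sum_(z <- dom x) (a * coeff z x) *: (z : M).
    rewrite -[a *: x]/(fgscale a x) /fgscale raddf_sum.
    by apply: eq_bigr => z _; exact: liftU.
  rewrite -[in RHS](freeg_sumE x) raddf_sum scaler_sumr.
  by apply: eq_bigr => z _; rewrite [f _]liftU scalerA.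
by move=> a x y; rewrite -[cover_map _]/(f _) raddfD fZ.
Qed.
HB.instance Definition _ :=
  GRing.isLinear.Build R free_cover M _ cover_map cover_map_is_linear.

Lemma cover_map_surj (y : M) : exists x, cover_map x = y.
Proof. by exists << 1 *g y >>; rewrite /cover_map liftU scale1r. Qed.

Definition cover_ker_pred : {pred free_cover} := fun x => cover_map x == 0.

Lemma cover_ker_closed : GRing.submod_closed cover_ker_pred.
Proof.
split=> [|a x y]; first by rewrite /cover_ker_pred unfold_in linear0.
move=> /eqP x0 /eqP y0; apply/eqP.
by rewrite cover_map_is_linear x0 y0 scaler0 addr0.
Qed.
HB.instance Definition _ := GRing.isSubmodClosed.Build R free_cover
  cover_ker_pred cover_ker_closed.

Definition cover_ker : lmodType R := sub_lmod cover_ker_pred.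

End FreeCover.

(* The standard free resolution                                               *)
(*   ... -> resol M 1 -> resol M 0 -> M -> 0                                  *)
(* where resol M n is the free cover of the n-th syzygy module of M; its      *)
(* augmentation is @cover_map R M.                                            *)
Section Resolution.
Variables (R : comNzRingType) (M : lmodType R).

Fixpoint syzygy (n : nat) : lmodType R :=
  if n is n'.+1 then cover_ker (syzygy n') else M.

Definition resol (n : nat) : lmodType R := free_cover (syzygy n).

Definition resol_d (n : nat) (x : resol n.+1) : resol n :=
  \val (cover_map x : cover_ker (syzygy n)).

Lemma resol_d_is_linear n : linear (@resol_d n).
Proof. by move=> a x y; rewrite /resol_d linearP. Qed.
HB.instance Definition _ n :=
  GRing.isLinear.Build R (resol n.+1) (resol n) _ (@resol_d n)
    (@resol_d_is_linear n).

Lemma resol_exact_aug (x : resol 0) :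
  cover_map x = 0 <-> exists y, x = @resol_d 0 y.
Proof.
split=> [x0|[y ->]]; last by apply/eqP; exact: (valP (cover_map y)).
have x_ker : x \in @cover_ker_pred R M by apply/eqP.
have [y yx] := cover_map_surj (exist _ x x_ker : cover_ker M).
by exists y; rewrite /resol_d yx.
Qed.

Lemma resol_exact n (x : resol n.+1) :
  resol_d x = 0 <-> exists y, x = @resol_d n.+1 y.
Proof.
split=> [x0|[y ->]]; last first.
  by rewrite {1}/resol_d; have /eqP-> := valP (cover_map y); rewrite linear0.
have x_ker : x \in @cover_ker_pred R (syzygy n.+1).
  by apply/eqP/val_inj; rewrite linear0.
have [y yx] := cover_map_surj (exist _ x x_ker : cover_ker (syzygy n.+1)).
by exists y; rewrite /resol_d yx.
Qed.

End Resolution.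

(* Ext^n(M, N), the n-th cohomology of the complex Hom(resol M _, N); its     *)
(* n-cochains are the linear functions in the module of all functions from    *)
(* resol M n to N.                                                            *)
Section Ext.
Variables (R : comNzRingType) (M N : lmodType R).

Definition is_coboundary (n : nat) : (resol M n -> N) -> Prop :=
  match n with
  | 0 => fun f => f = 0
  | n'.+1 => fun f =>
      exists2 h : resol M n' -> N, linear h & f = h \o @resol_d R M n'
  end.

Lemma is_coboundary0 n : @is_coboundary n 0.
Proof.
by case: n => //= n; exists 0 => // a x y; rewrite scaler0 addr0.
Qed.

Lemma linear_comb n a (f g : resol M n -> N) :
  linear f -> linear g -> linear (a *: f + g).
Proof.
move=> fl gl b x y; rewrite !fctE fl gl !scalerDr !scalerA [a * b]mulrC.
by rewrite addrACA.
Qed.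

Lemma is_coboundary_comb n a (f g : resol M n -> N) :
  is_coboundary f -> is_coboundary g -> is_coboundary (a *: f + g).
Proof.
case: n f g => [|n] f g /=; first by move=> -> ->; rewrite scaler0 addr0.
move=> [h hl ->] [k kl ->].
by exists (a *: h + k); [exact: linear_comb | apply/funext].
Qed.

Variable n : nat.

Definition cocycle : {pred (resol M n -> N)} :=
  fun f => `[< linear f /\ f \o @resol_d R M n = 0 >].

Lemma cocycle_closed : GRing.submod_closed cocycle.
Proof.
split=> [|a f g /asboolP[fl fd] /asboolP[gl gd]]; apply/asboolP; split.
- by move=> a x y; rewrite scaler0 addr0.
- by [].
- exact: linear_comb.
- apply/funext => x; rewrite /= !fctE.
  have /= -> := congr1 (@^~ x) fd; have /= -> := congr1 (@^~ x) gd.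
  by rewrite scaler0 addr0.
Qed.
HB.instance Definition _ :=
  GRing.isSubmodClosed.Build R (resol M n -> N) cocycle cocycle_closed.

Definition coboundary : {pred (sub_lmod cocycle)} :=
  fun f => `[< is_coboundary (\val f) >].

Lemma coboundary_closed : GRing.submod_closed coboundary.
Proof.
split=> [|a f g /asboolP fb /asboolP gb]; apply/asboolP.
  by rewrite linear0; exact: is_coboundary0.
by rewrite linearP; exact: is_coboundary_comb.
Qed.
HB.instance Definition _ :=
  GRing.isSubmodClosed.Build R (sub_lmod cocycle) coboundary coboundary_closed.

Definition Ext : lmodType R := quot_lmod coboundary.

End Ext.

Definition Ann (R : comNzRingType) (M : lmodType R) : set R :=
  [set r | forall x : M, r *: x = 0].

Definition D (R : comNzRingType) (I : ideal R) : set R :=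
  Ann (Ext (quot_lmod I) R^o (grade I)).

(* Main.v *)
Require Import Defs.
From HB Require Import structures.
From mathcomp Require Import all_boot all_order all_algebra all_classical.
From mathcomp Require Import freeg.
From mathcomp Require Import ring.


(** Let [s] be a regular sequence of length [n] contained in an ideal [I].
Since [s] kills R/I, dimension shifting along multiplication by its members
gives

  Ext^n(R/I, R) = Hom(R/I, R/(s)) = ((s) : I) / (s),

so [r] lies in the annihilator of Ext^n(R/I, R) exactly when it maps the colon
ideal (s) : I into (s) ([D_colonP], for n the grade of I).  If I1 is contained
in I2 and both have grade n, one sequence [s] in I1 serves both ideals, and
(s) : I2 is contained in (s) : I1; hence D(I1) is contained in D(I2)
([D_sub]).

The shift is carried out on cochains.  Let F be a free resolution of a module
M.  As each F_n is free, a cochain with values in R/J lifts to a linear map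
F_n -> R, and the cocycle and coboundary conditions become conditions modulo J
on maps to R; [kills_ext] says in these terms that [r] annihilates
Ext^n(M, R/J).  For [x] that kills M and is a nonzerodivisor modulo J,
annihilating Ext^(n+1)(M, R/J) is equivalent to annihilating
Ext^n(M, R/(J + xR)), one direction using that Ext^n(M, R/J) vanishes
([kills_extS], [kills_extS_inv], [ext_vanish]).

For the chain of powers one needs that I and I^m have the same grade.  The
m-th powers of the members of a regular sequence again form a regular sequence
([regular_seq_exp]), so the lengths of the regular sequences in I and in I^m
are the same ([grade_exp]). *)

Set Implicit Arguments.
Unset Strict Implicit.
Unset Printing Implicit Defensive.

Import GRing.Theory.

Local Open Scope quotient_scope.
Local Open Scope classical_set_scope.
Local Open Scope ring_scope.

(** * Ideals obtained by adjoining elements *)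

Section Adjoin.
Variable R : comNzRingType.
Implicit Types (J K : ideal R) (x a : R) (s : seq R).

Lemma ideal_rpredN J (a : R) : (a : R^o) \in J -> (- a : R^o) \in J.
Proof. by move=> Ja; rewrite -mulN1r; exact: (rpredZ (-1) Ja). Qed.

Lemma ideal_rpredB J (a b : R) : (a : R^o) \in J -> (b : R^o) \in J ->
  (a - b : R^o) \in J.
Proof. by move=> Ja Jb; rewrite rpredD // ideal_rpredN. Qed.

Lemma ideal_mulr J (a b : R) : (b : R^o) \in J -> (a * b : R^o) \in J.
Proof. by move=> Jb; exact: (rpredZ a Jb). Qed.

(** The successive quotients of a regular sequence start from R/0; all later
ideals arise from the zero ideal by adjoining one element at a time. *)
Definition zero_ideal_pred : {pred R^o} := fun a => a == 0.

Lemma zero_ideal_closed : GRing.submod_closed zero_ideal_pred.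
Proof.
split=> [|a b c /eqP -> /eqP ->]; first exact: eqxx.
by rewrite scaler0 addr0; exact: eqxx.
Qed.
HB.instance Definition _ :=
  GRing.isSubmodClosed.Build R R^o zero_ideal_pred zero_ideal_closed.

Definition zero_ideal : ideal R := zero_ideal_pred.

Lemma in_zero_ideal (a : R^o) : (a \in zero_ideal) = (a == 0).
Proof. by []. Qed.

Definition adjoin_pred J x : {pred R^o} :=
  fun a => `[< exists t : R, (a - t * x : R^o) \in J >].

Lemma adjoin_closed J x : GRing.submod_closed (adjoin_pred J x).
Proof.
split=> [|a b c /asboolP[t Jt] /asboolP[u Ju]]; apply/asboolP.
  by exists 0; rewrite mul0r subr0 rpred0.
exists (a * t + u); rewrite mulrDl opprD addrACA rpredD //.
by rewrite -mulrA -mulrBr ideal_mulr.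
Qed.
HB.instance Definition _ J x :=
  GRing.isSubmodClosed.Build R R^o (adjoin_pred J x) (adjoin_closed J x).

Definition adjoin J x : ideal R := adjoin_pred J x.

Lemma adjoinP J x (a : R^o) :
  reflect (exists t : R, (a - t * x : R^o) \in J) (a \in adjoin J x).
Proof. exact: asboolP. Qed.

Lemma adjoin_sub J x : {subset J <= adjoin J x}.
Proof. by move=> a Ja; apply/adjoinP; exists 0; rewrite mul0r subr0. Qed.

Lemma adjoin_gen J x : (x : R^o) \in adjoin J x.
Proof. by apply/adjoinP; exists 1; rewrite mul1r subrr rpred0. Qed.

Definition adjoins J s : ideal R := foldl adjoin J s.

Lemma adjoins_sub J s : {subset J <= adjoins J s}.
Proof.
elim: s J => [|x s IH] J a Ja; first by [].
exact/IH/adjoin_sub.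
Qed.

Lemma adjoins_gen J s x : x \in s -> (x : R^o) \in adjoins J s.
Proof.
elim: s J => [//|y s IH] J; rewrite in_cons => /orP[/eqP->|/IH]; last by apply.
exact: (adjoins_sub s (adjoin_gen J y)).
Qed.

Lemma adjoins_min J K s : {subset J <= K} ->
  (forall x, x \in s -> (x : R^o) \in K) -> {subset adjoins J s <= K}.
Proof.
elim: s J => [|x s IH] J JK sK; first by [].
apply: IH => [a /adjoinP[t Jt]|y ys].
  rewrite -[a](subrK (t * x)) rpredD //; first exact: JK.
  by rewrite ideal_mulr // sK // mem_head.
by rewrite sK // in_cons ys orbT.
Qed.

Lemma ideal_gen_sub (S : set R) x : S x -> (x : R^o) \in ideal_gen S.
Proof. by move=> Sx; apply/asboolP => J; apply. Qed.

Lemma ideal_gen_min (S : set R) J :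
  (forall x, S x -> (x : R^o) \in J) -> {subset ideal_gen S <= J}.
Proof. by move=> SJ x /asboolP; apply. Qed.

Lemma adjoins0E s : adjoins zero_ideal s =i ideal_gen [set` s].
Proof.
move=> a; apply/idP/idP.
  apply: adjoins_min => [b|x xs]; last exact: ideal_gen_sub.
  by rewrite in_zero_ideal => /eqP->; rewrite rpred0.
by apply: ideal_gen_min => x; exact: adjoins_gen.
Qed.

End Adjoin.

(** * Regular sequences and their powers *)

Section RegularSequences.
Variable R : comNzRingType.
Implicit Types (J : ideal R) (x y : R) (s : seq R).

Definition nzd_mod J x := forall a : R, (x * a : R^o) \in J -> (a : R^o) \in J.

(** Regularity on R/J, without the requirement that the last quotient be
nonzero: in this recursive form it passes to J + xR when the head [x] is
removed, which is what every induction below uses. *)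
Fixpoint weakly_regular J s : Prop :=
  if s is x :: s' then nzd_mod J x /\ weakly_regular (adjoin J x) s' else True.

Lemma weakly_regularP J s : weakly_regular J s <->
  forall i, (i < size s)%N -> nzd_mod (adjoins J (take i s)) s`_i.
Proof.
elim: s J => [|x s IH] J //=; split=> [[Jx /IH sreg] [|i]//|sreg].
  exact: sreg.
by split; [exact: (sreg 0%N) | apply/IH => i; exact: (sreg i.+1)].
Qed.

Lemma regular_seqE s : regular_seq s <->
  is_proper (ideal_gen [set` s]) /\ weakly_regular (zero_ideal R) s.
Proof.
split=> -[prop sreg]; split=> //.
  by apply/weakly_regularP => i si a; rewrite !adjoins0E; exact: sreg.
move/weakly_regularP: sreg => sreg i si a; rewrite -!adjoins0E.
exact: sreg.
Qed.

(** The hypotheses say that multiplication by [x] gives an exact sequence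
0 -> R/A -> R/C -> R/B -> 0 with B = C + xR.  A sequence that is weakly regular
on both ends is so on the middle term: a nonzerodivisor on the ends is one on
the middle, and the sequence stays exact modulo such an element. *)
Lemma weakly_regular_middle x (A B C : ideal R) s :
    {subset C <= B} -> (x : R^o) \in B ->
    (forall b : R, (b : R^o) \in B -> (b : R^o) \in adjoin C x) ->
    (forall a : R, ((x * a : R^o) \in C) = ((a : R^o) \in A)) ->
  weakly_regular A s -> weakly_regular B s -> weakly_regular C s.
Proof.
elim: s A B C => //= z s IH A B C CB Bx BC CA [Az Asreg] [Bz Bsreg]; split.
  move=> a Cza; have /BC/adjoinP[t Ct] := Bz a (CB _ Cza).
  rewrite -[a](subrK (t * x)) rpredD // mulrC CA; apply: Az; rewrite -CA.
  have -> : x * (z * t) = z * a - z * (a - t * x) by ring.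
  by rewrite ideal_rpredB // ideal_mulr.
apply: (IH (adjoin A z) (adjoin B z)) => //.
- by move=> c /adjoinP[t Ct]; apply/adjoinP; exists t; exact: CB.
- exact: adjoin_sub.
- move=> b /adjoinP[u /BC/adjoinP[t Ct]]; apply/adjoinP; exists t.
  apply/adjoinP; exists u.
  by rewrite addrAC.
move=> a; apply/adjoinP/adjoinP=> [[u Cu]|[u Au]].
  (* Exactness modulo z on the left: x a = z u modulo C forces u into B. *)
  have /BC/adjoinP[t Ct] : (u : R^o) \in B.
    apply: Bz; rewrite -[z * u](subKr (x * a)) ideal_rpredB //.
      by rewrite mulrC ideal_mulr.
    by apply: CB; rewrite [z * u]mulrC.
  exists t; rewrite -CA.
  have -> : x * (a - t * z) = x * a - u * z + z * (u - t * x) by ring.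
  by rewrite rpredD // ideal_mulr.
exists (x * u); rewrite -CA in Au.
by rewrite -mulrA -mulrBr.
Qed.

(** Apply [weakly_regular_middle] to
0 -> R/(J + yR) -> R/(J + xyR) -> R/(J + xR) -> 0. *)
Lemma weakly_regular_mul J x y s : weakly_regular J (x :: s) ->
  weakly_regular J (y :: s) -> weakly_regular J (x * y :: s).
Proof.
move=> /= [Jx xs] [Jy ys]; split=> [a|]; first by rewrite -mulrA => /Jx/Jy.
apply: (weakly_regular_middle (x := x) _ _ _ _ ys xs).
- move=> c /adjoinP[t Jt]; apply/adjoinP; exists (t * y).
  by rewrite -mulrA [y * x]mulrC.
- exact: adjoin_gen.
- move=> b /adjoinP[t Jt]; apply/adjoinP; exists t; exact: adjoin_sub.
move=> a; apply/adjoinP/adjoinP=> -[t Jt]; exists t.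
  by apply: Jx; rewrite mulrBr mulrCA.
by rewrite mulrCA -mulrBr ideal_mulr.
Qed.

(** The head is raised to its power first, by repeated multiplication; what is
left is weakly regular modulo the new head, and induction applies there. *)
Lemma weakly_regular_exp J s m :
  weakly_regular J s -> weakly_regular J [seq x ^+ m.+1 | x <- s].
Proof.
elim: s J => //= x s IH J xs.
have /= [Jx sreg] : weakly_regular J (x ^+ m.+1 :: s).
  elim: m {IH} => [|m IHm]; first by rewrite expr1.
  by rewrite exprS; exact: weakly_regular_mul.
by split=> //; exact: IH.
Qed.

Lemma regular_seq_exp s m :
  regular_seq s -> regular_seq [seq x ^+ m.+1 | x <- s].
Proof.
move=> /regular_seqE[prop sreg]; apply/regular_seqE; split; last first.
  exact: weakly_regular_exp.
apply: contra prop; apply: ideal_gen_min => _ /mapP[x xs ->].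
by rewrite exprSr ideal_mulr // ideal_gen_sub.
Qed.

End RegularSequences.

(** * The grade of a power *)

Section Powers.
Variable R : comNzRingType.
Implicit Types I : ideal R.

Lemma ideal_exp_subS I n : {subset ideal_exp I n.+1 <= ideal_exp I n}.
Proof. by apply: ideal_gen_min => _ [a [b [_ bI ->]]]; exact: ideal_mulr. Qed.

Lemma ideal_exp_sub I n : (0 < n)%N -> {subset ideal_exp I n <= I}.
Proof.
case: n => // n _; apply: ideal_gen_min => _ [a [b [aI _ ->]]].
by rewrite mulrC; exact: ideal_mulr.
Qed.

Lemma mem_ideal_exp I (a : R) n :
  (a : R^o) \in I -> (a ^+ n : R^o) \in ideal_exp I n.
Proof.
move=> aI; elim: n => [|n IHn]; first exact: ideal_gen_sub.
by rewrite exprS; apply: ideal_gen_sub; exists a, (a ^+ n).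
Qed.

(** Regular sequences in a power of I lie in I, and those in I can be moved
into the power by [regular_seq_exp] without changing the length. *)
Lemma is_grade_exp I n : is_grade (ideal_exp I n.+1) = is_grade I.
Proof.
have down s : all [in ideal_exp I n.+1] s -> all [in I] s.
  by apply: sub_all => x; exact: ideal_exp_sub.
have up s : all [in I] s -> all [in ideal_exp I n.+1] [seq x ^+ n.+1 | x <- s].
  by rewrite all_map; apply: sub_all => x; exact: mem_ideal_exp.
apply/funext => g; apply/propext.
split=> -[[s [sI sreg sg]] gmax]; split.
- by exists s; split=> //; exact: down.
- move=> t /up tI treg.
  by have := gmax _ tI (regular_seq_exp _ treg); rewrite size_map.
- exists [seq x ^+ n.+1 | x <- s]; split; rewrite ?size_map ?up //.
  exact: regular_seq_exp.
- by move=> t /down tI; exact: gmax.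
Qed.

Lemma grade_exp I n : (0 < n)%N -> grade (ideal_exp I n) = grade I.
Proof. by case: n => // n _; rewrite /grade is_grade_exp. Qed.

(** When the lengths of regular sequences in I have no maximum, [grade I] is 0
by convention, and the empty sequence has that length. *)
Lemma grade_attained I : exists s : seq R,
  [/\ all [in I] s, weakly_regular (zero_ideal R) s & size s = grade I].
Proof.
rewrite /grade; case: xgetP => [_ -> [[s [sI /regular_seqE[_ sreg] sg]] _]|_].
  by exists s.
by exists [::].
Qed.

End Powers.

(** * Lifting from free modules *)

Section FreeLift.
Variables (R : comNzRingType) (V : lmodType R).

(** Projectivity in a form that covers all the choices made along free modules
below: a relation that is total and compatible with linear combinations
contains the graph of a linear map.  The usual lifting of [f] along [p] is the
case of the relation f x = p a. *)
Definition lifts_relations (L : lmodType R) :=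
  forall (A : lmodType R) (P : L -> A -> Prop),
    (forall x, exists a, P x a) ->
    (forall c x y a b, P x a -> P y b -> P (c *: x + y) (c *: a + b)) ->
  exists h : {linear L -> A}, forall x, P x (h x).

Lemma fglift_is_linear (A : lmodType R) (u : V -> A) :
  linear (fglift u : free_cover V -> A).
Proof.
pose fD := GRing.isZmodMorphism.Build (free_cover V) A (fglift u)
  (lift_is_additive (R := R) u).
pose f : {additive free_cover V -> A} :=
  HB.pack_for {additive free_cover V -> A}
    (fglift u : free_cover V -> A) fD.
have fZ a (x : free_cover V) : f (a *: x) = a *: f x.
  rewrite -[a *: x]/(fgscale a x) /fgscale -[in RHS](freeg_sumE x) raddf_sum.
  rewrite raddf_sum scaler_sumr; apply: eq_bigr => v _.
  by rewrite ![f _]liftU scalerA.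
by move=> a x y; rewrite -[fglift u]/(f : _ -> _) raddfD fZ.
Qed.

(** Choose a value on each basis element and extend linearly. *)
Lemma free_lift : lifts_relations (free_cover V).
Proof.
move=> A P Pex Plin.
have P0 : P 0 0.
  have [a P0a] := Pex 0.
  by have := Plin (-1) _ _ _ _ P0a P0a; rewrite scaler0 addr0 scaleN1r addNr.
pose e (v : V) : free_cover V := << v >>.
have [u Pu] : exists u : V -> A, forall v, P (e v) (u v).
  exists (fun v => xget 0 (P (e v))) => v.
  by have [a Pa] := Pex (e v); apply: (xgetPex 0); exists a.
pose h : {linear free_cover V -> A} := HB.pack (fglift u : free_cover V -> A)
  (GRing.isLinear.Build R (free_cover V) A _ _ (fglift_is_linear u)).
exists h => x.
have -> : x = \sum_(v <- dom x) coeff v x *: e v.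
  rewrite -[LHS]freeg_sumE; apply: eq_bigr => v _.
  by apply/eqP/freeg_eqP => w; rewrite coeffZ !coeffU mul1r.
rewrite linear_sum; apply: (big_ind2 P) => // [y a z b Py Pz|v _].
  by have := Plin 1 _ _ _ _ Py Pz; rewrite !scale1r.
have -> : h (coeff v x *: e v) = coeff v x *: u v.
  by rewrite linearZ /= liftU scale1r.
by have := Plin (coeff v x) _ _ _ _ (Pu v) P0; rewrite !addr0.
Qed.

End FreeLift.

(** * Annihilators of Ext with values in R/J, and dimension shifting *)

Section ExtModIdeal.
Variables (R : comNzRingType) (M : lmodType R) (F : nat -> lmodType R).
Variables (aug : {linear F 0 -> M}) (d : forall n, {linear F n.+1 -> F n}).
Arguments d {n}.
Hypothesis aug_exact :
  forall y : F 0, aug y = 0 <-> exists z : F 1, y = d z.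
Hypothesis d_exact :
  forall n (y : F n.+1), d y = 0 <-> exists z : F n.+2, y = d z.
Hypothesis F_lift : forall n, lifts_relations (F n).
Implicit Types (J : ideal R) (r x : R) (n : nat).

Lemma d_d0 n (y : F n.+2) : d (d y) = 0.
Proof. by apply/d_exact; exists y. Qed.

Lemma lift_cycle n (f : {linear F n.+1 -> F n.+1}) :
    (forall y, d (f y) = 0) ->
  exists h : {linear F n.+1 -> F n.+2}, forall y, f y = d (h y).
Proof.
move=> df.
apply: (F_lift (P := fun y z => f y = d z)) => [y|c y z a b fy fz].
  exact/d_exact.
by rewrite !linearP fy fz.
Qed.

Definition killed_by x := forall m : M, x *: m = 0.

(** Multiplication by an element that kills M lifts the zero map of M, so it
is null-homotopic on the resolution. *)
Lemma scale_homotopy x : killed_by x -> forall n,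
  exists h : {linear F n -> F n.+1}, exists h' : {linear F n.+1 -> F n.+2},
    forall y, x *: y = d (h' y) + h (d y).
Proof.
move=> xM.
(* This weaker identity at one degree is what the construction of the next
   stage of the homotopy needs: it makes x y - h (d y) a cycle. *)
suff htpy n : exists h : {linear F n -> F n.+1},
    forall y, d (h (d y)) = x *: d y.
  move=> n; have [h dh] := htpy n; exists h.
  pose p : {linear F n.+1 -> F n.+1} :=
    GRing.sub_fun (x \*: idfun) (h \o d).
  have [|h' ph'] := @lift_cycle n p; last first.
    by exists h' => y; rewrite -ph' /= subrK.
  by move=> y; rewrite /= linearB linearZ /= dh subrr.
elim: n => [|n [h dh]].
  have [|c y z a b dy dz|h dh] := @F_lift 0 (F 1) (fun y z => x *: y = d z).
  - by move=> y; apply/aug_exact; rewrite linearZ /= xM.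
  - by rewrite linearP -dy -dz scalerDr !scalerA mulrC.
  by exists h => y; rewrite -dh.
pose p : {linear F n.+1 -> F n.+1} :=
  GRing.sub_fun (x \*: idfun) (h \o d).
have [|h' ph'] := @lift_cycle n p.
  by move=> y; rewrite /= linearB linearZ /= dh subrr.
by exists h' => y; rewrite -ph' /= d_d0 linear0 subr0.
Qed.

(** A map F_n -> R that is a coboundary once its values are taken in R/J. *)
Definition coboundary_mod J n : (F n -> R) -> Prop :=
  match n with
  | 0 => fun f => forall y, (f y : R^o) \in J
  | n'.+1 => fun f => exists h : {linear F n' -> R^o},
      forall y, (f y - h (d y) : R^o) \in J
  end.

(** [r] annihilates Ext^n(M, R/J), where M is the module resolved by F. *)
Definition kills_ext r J n := forall f : {linear F n -> R^o},
  (forall y, f (d y) \in J) -> coboundary_mod J (fun y => r * f y).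

(** A map with values in J + xR is x u modulo J for some linear u, because F_n
is free. *)
Lemma adjoin_split J x n (f : {linear F n -> R^o}) :
    (forall y, f y \in adjoin J x) ->
  exists u : {linear F n -> R^o}, forall y, (f y - x * u y : R^o) \in J.
Proof.
move=> fJ.
apply: (F_lift (P := fun y (u : R^o) => (f y - x * u : R^o) \in J))
  => [y|c y z a b Jy Jz].
  by have /adjoinP[t Jt] := fJ y; exists t; rewrite mulrC.
have -> : f (c *: y + z) - x * (c *: a + b) =
    c * (f y - x * a) + (f z - x * b).
  by rewrite linearP /GRing.scale /=; ring.
by rewrite rpredD // ideal_mulr.
Qed.

(** The correction by which [f] differs from a coboundary modulo J + xR can be
taken of the form x u modulo J; composing with [d] removes the coboundary. *)
Lemma coboundary_mod_d J x n (f : {linear F n -> R^o}) :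
    coboundary_mod (adjoin J x) f ->
  exists u : {linear F n -> R^o}, forall y : F n.+1,
    (f (d y) - x * u (d y) : R^o) \in J.
Proof.
case: n f => [|n] f /=.
  move=> fJ; have [u uJ] := @adjoin_split J x 0 f fJ.
  by exists u => y; exact: uJ.
move=> [k fk].
have [u uJ] := @adjoin_split J x n.+1 (GRing.sub_fun f (k \o d)) fk.
by exists u => y; have := uJ (d y); rewrite /= d_d0 linear0 subr0.
Qed.

(** A cocycle [g] of degree n+1 modulo J is in the image of the connecting map:
by the homotopy, x g is the coboundary of some [f] modulo J, and [f] is then a
cocycle of degree n modulo J + xR.  A bounding of r f gives one of r x g, and
[x] cancels modulo J. *)
Lemma kills_extS J r x n : killed_by x -> nzd_mod J x ->
  kills_ext r (adjoin J x) n -> kills_ext r J n.+1.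
Proof.
move=> xM Jx kr g gJ.
have [h [h' hh']] := scale_homotopy xM n.
pose f : {linear F n -> R^o} := g \o h.
have xg y : (x * g y - f (d y) : R^o) \in J.
  have -> : x * g y = g (x *: y) by rewrite linearZ.
  by rewrite hh' linearD /= addrK.
have fJ y : f (d y) \in adjoin J x.
  apply/adjoinP; exists (g y).
  by rewrite -opprB ideal_rpredN // mulrC.
have [u uJ] := @coboundary_mod_d J x n (r \*: f) (kr f fJ).
exists u => y; apply: Jx.
have -> : x * (r * g y - u (d y)) =
    r * (x * g y - f (d y)) + (r * f (d y) - x * u (d y)) by ring.
by apply: rpredD; [exact: ideal_mulr | exact: uJ].
Qed.

(** The connecting map sends a cocycle [f] modulo J + xR to the [g] with
f d = x g modulo J.  If r g is bounded by [h], then r f - x h is a cocycle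
modulo J, hence a coboundary since Ext^n(M, R/J) is zero (stated here as: 1
annihilates it), and r f is a coboundary modulo J + xR. *)
Lemma kills_extS_inv J r x n : nzd_mod J x -> kills_ext 1 J n ->
  kills_ext r J n.+1 -> kills_ext r (adjoin J x) n.
Proof.
move=> Jx k1 kr f fJ.
have [g gJ] := @adjoin_split J x n.+1 (f \o d) fJ.
have [|h hJ] := kr g.
  move=> y; apply: Jx; rewrite -[x * _]opprK ideal_rpredN //.
  by have := gJ (d y); rewrite /= d_d0 linear0 sub0r.
pose p : {linear F n -> R^o} := GRing.sub_fun (r \*: f) (x \*: h).
have pJ y : p (d y) \in J.
  have -> : p (d y) = r * (f (d y) - x * g y) + x * (r * g y - h (d y)).
    by rewrite /= /GRing.scale /=; ring.
  by apply: rpredD; apply: ideal_mulr; [exact: gJ | exact: hJ].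
move: (k1 p pJ); rewrite {pJ}/p.
case: n f h {kr fJ g gJ hJ k1} => [|n] f h pJ.
  move=> y; apply/adjoinP; exists (h y).
  by have := pJ y; rewrite mul1r /= /GRing.scale /= [x * _]mulrC.
have [k kJ] := pJ; exists k => y; apply/adjoinP; exists (h y).
by have := kJ y; rewrite mul1r /= /GRing.scale /= [x * _]mulrC addrAC.
Qed.

(** Hom(M, R/J) is zero: its values are killed by [x], which is a
nonzerodivisor on R/J. *)
Lemma kills_ext0 J r x : killed_by x -> nzd_mod J x ->
  kills_ext r J 0.
Proof.
move=> xM Jx f fJ y; apply/ideal_mulr/Jx.
have /aug_exact[z xy] : aug (x *: y) = 0 by rewrite linearZ /= xM.
have -> : x * f y = f (x *: y) by rewrite linearZ.
by rewrite xy.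
Qed.

(** Ext^n(M, R/J) is zero below the length of a weakly regular sequence that
kills M.  Vanishing is annihilation by 1, so [kills_extS] with r = 1 gives the
induction. *)
Lemma ext_vanish J s n : (forall x, x \in s -> killed_by x) ->
  weakly_regular J s -> (n < size s)%N -> kills_ext 1 J n.
Proof.
elim: s J n => // x s IH J n sM /= [Jx sreg] ns.
have xM : killed_by x by apply: sM; rewrite mem_head.
case: n ns => [|n] ns; first exact: kills_ext0 Jx.
apply: (kills_extS xM Jx); apply: IH => // y ys; apply: sM.
by rewrite in_cons ys orbT.
Qed.

Lemma kills_ext_shift J r s : (forall x, x \in s -> killed_by x) ->
  weakly_regular J s -> kills_ext r J (size s) <-> kills_ext r (adjoins J s) 0.
Proof.
elim: s J => [|x s IH] J sM //= [Jx sreg].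
have xM : killed_by x by apply: sM; rewrite mem_head.
have <- : kills_ext r (adjoin J x) (size s) <->
    kills_ext r (adjoins (adjoin J x) s) 0.
  apply: IH => //.
  by move=> y ys; apply: sM; rewrite in_cons ys orbT.
split; last exact: kills_extS.
by apply: kills_extS_inv => //; apply: (@ext_vanish J (x :: s)).
Qed.

End ExtModIdeal.

(** * The annihilator of Ext of a cyclic module *)

Section QuotientMap.
Variables (R : comNzRingType) (V : lmodType R) (U : submodClosed V).

(** The projection onto the quotient, named so that it carries a linear
structure for [quot_lmod]. *)
Definition quot_pi (v : V) : quot_lmod U :=
  \pi_(Quotient.quot (submod_zmod U)) v.

Lemma quot_pi_is_linear : linear quot_pi.
Proof.
move=> a v w; rewrite /quot_pi raddfD; congr (_ + _).
exact: pi_quot_scale.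
Qed.
HB.instance Definition _ :=
  GRing.isLinear.Build R V (quot_lmod U) _ quot_pi quot_pi_is_linear.

Lemma quot_pi_eq0 v : (quot_pi v == 0) = (v \in U).
Proof.
rewrite -[v in RHS]subr0 -[RHS]/(_ \in submod_zmod U) Quotient.idealrBE.
by rewrite -(linear0 quot_pi).
Qed.

Lemma scale_quot_pi_eq0 a v : (a *: quot_pi v == 0) = (a *: v \in U).
Proof. by rewrite -linearZ quot_pi_eq0. Qed.

Lemma quot_pi_surj (q : quot_lmod U) : exists v, q = quot_pi v.
Proof. by exists (repr q); rewrite /quot_pi reprK. Qed.

End QuotientMap.

Section StandardResolution.
Variables (R : comNzRingType) (M : lmodType R).
Implicit Types (J : ideal R) (r x : R) (n : nat).

Definition std_d n : {linear resol M n.+1 -> resol M n} := @resol_d R M n.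

(** For J = 0 the conditions modulo J are the equalities that define cocycles
and coboundaries with values in R. *)
Lemma Ann_ExtP r n :
  Ann (Ext M R^o n) r <-> kills_ext std_d r (zero_ideal R) n.
Proof.
have cobE (f : {linear resol M n -> R^o}) :
    is_coboundary (r *: (f : resol M n -> R^o)) <->
    coboundary_mod std_d (zero_ideal R) (fun y => r * f y).
  case: n f => [|k] f /=.
    split=> [f0 y|f0]; first by apply/eqP/(congr1 (@^~ y) f0).
    by apply/funext => y; apply/eqP; exact: f0.
  split=> [[h hl fh]|[h hJ]].
    pose h' : {linear resol M k -> R^o} := HB.pack h
      (GRing.isLinear.Build R (resol M k) R^o _ h hl).
    exists h' => y; rewrite in_zero_ideal subr_eq0; apply/eqP.
    exact: (congr1 (@^~ y) fh).
  exists h; first exact: linearP.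
  by apply/funext => y; apply/eqP; rewrite -subr_eq0; exact: hJ.
split=> [rE f fJ|kr e].
  apply/cobE.
  have fZ : (f : resol M n -> R^o) \in @cocycle R M R^o n.
    apply/asboolP; split; first exact: linearP.
    by apply/funext => y; apply/eqP; exact: fJ.
  pose c : sub_lmod (@cocycle R M R^o n) :=
    exist (fun g => g \in @cocycle R M R^o n) _ fZ.
  have /eqP := rE (quot_pi (@coboundary R M R^o n) c).
  by rewrite scale_quot_pi_eq0 => /asboolP.
have [c ->] := quot_pi_surj e; apply/eqP.
rewrite scale_quot_pi_eq0; apply/asboolP.
case: c => f /= fZ; have /asboolP[fl fd] := fZ.
pose f' : {linear resol M n -> R^o} := HB.pack f
  (GRing.isLinear.Build R (resol M n) R^o _ f fl).
apply/(cobE f')/kr => y; apply/eqP; exact: (congr1 (@^~ y) fd).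
Qed.

Lemma kills_ext_std_shift J r s :
    (forall x, x \in s -> killed_by M x) -> weakly_regular J s ->
  kills_ext std_d r J (size s) <-> kills_ext std_d r (adjoins J s) 0.
Proof.
apply: (@kills_ext_shift R M (resol M) (@cover_map R M) std_d).
- exact: resol_exact_aug.
- by move=> n y; exact: resol_exact.
- by move=> n; exact: free_lift.
Qed.

End StandardResolution.

Section CyclicModule.
Variables (R : comNzRingType) (I : ideal R).
Implicit Types (J : ideal R) (r : R).

Lemma quot_killed_by x : (x : R^o) \in I -> killed_by (quot_lmod I) x.
Proof.
move=> xI m; have [c ->] := quot_pi_surj m.
apply/eqP; rewrite scale_quot_pi_eq0 /GRing.scale /= mulrC.
exact: ideal_mulr.
Qed.

(** Homomorphisms R/I -> R/J correspond to the classes of elements [a] of the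
colon ideal J : I, through the image of 1. *)
Lemma kills_hom_quotP J r :
  kills_ext (@std_d R (quot_lmod I)) r J 0 <->
  forall a : R, (forall y : R, (y : R^o) \in I -> (y * a : R^o) \in J) ->
    (r * a : R^o) \in J.
Proof.
set M := quot_lmod I; split=> [kr a aJ|ra f fJ y]; last first.
  apply: ra => x xI.
  have /resol_exact_aug[z xy] : cover_map (x *: y) = 0.
    by rewrite linearZ /= quot_killed_by.
  have -> : x * f y = f (x *: y) by rewrite linearZ.
  by rewrite xy; exact: fJ.
(* The cochain attached to a: y is sent to c a modulo J, where c represents the
   class of y in R/I. *)
have [|c y z t u [b yb bt] [e ze eu]|f fP] := @free_lift R M R^o
    (fun y t => exists2 c : R^o, cover_map y = quot_pi I c & t - c * a \in J).
- move=> y; have [c yc] := quot_pi_surj (cover_map y).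
  by exists (c * a), c; rewrite // subrr rpred0.
- exists (c *: b + e).
    by rewrite cover_map_is_linear yb ze quot_pi_is_linear.
  have -> : c *: t + u - (c *: b + e) * a = c * (t - b * a) + (u - e * a).
    by rewrite /GRing.scale /=; ring.
  by apply: rpredD => //; exact: ideal_mulr.
have fJ y : f (@std_d R M 0 y) \in J.
  have [c dc fc] := fP (@std_d R M 0 y).
  have cI : c \in I.
    by rewrite -quot_pi_eq0 -dc; apply/eqP/resol_exact_aug; exists y.
  by rewrite -[f _](subrK (c * a)); apply: rpredD => //; exact: aJ.
have [y y1] := cover_map_surj (quot_pi I 1 : M).
have [c yc fc] := fP y.
have cI : (c - 1 : R^o) \in I by rewrite -quot_pi_eq0 linearB /= -yc y1 subrr.
have -> : r * a = r * f y - (r * (f y - c * a) + r * ((c - 1) * a)) by ring.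
apply: ideal_rpredB; first exact: (kr f fJ).
by apply: rpredD; apply: ideal_mulr => //; exact: aJ.
Qed.

Lemma D_colonP r s :
    all [in I] s -> weakly_regular (zero_ideal R) s -> size s = grade I ->
  D I r <-> forall a : R,
    (forall y : R, (y : R^o) \in I -> (y * a : R^o) \in ideal_gen [set` s]) ->
    (r * a : R^o) \in ideal_gen [set` s].
Proof.
move=> /allP sI sreg sg; rewrite /D; apply: (iff_trans (Ann_ExtP _ _ _)).
rewrite -sg; apply: (iff_trans (kills_ext_std_shift _ _ sreg)).
  by move=> x /sI; exact: quot_killed_by.
apply: (iff_trans (kills_hom_quotP _ _)).
by split=> ra a aJ; have := ra a; rewrite ?adjoins0E; apply=> y /aJ;
  rewrite adjoins0E.
Qed.

End CyclicModule.

(** * Monotonicity of D *)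

(** A regular sequence of length grade(I1) in I1 also lies in I2 and has there
the length of the grade, so both annihilators are read off from one
sequence. *)
Lemma D_sub (R : comNzRingType) (I1 I2 : ideal R) :
  {subset I1 <= I2} -> grade I1 = grade I2 -> D I1 `<=` D I2.
Proof.
move=> I12 g12 r; have [s [sI1 sreg sg]] := grade_attained I1.
have sI2 : all [in I2] s by apply: sub_all sI1 => x; exact: I12.
move=> /(D_colonP r sI1 sreg sg) ra.
apply/(D_colonP r sI2 sreg (etrans sg g12)) => a aI2.
by apply: ra => y /I12; exact: aI2.
Qed.

Theorem corollary3p5 (R : comNzRingType) (hN : noetherian R)
    (hL : local_ring R) :
  (forall I1 I2 : ideal R, is_proper I1 -> is_proper I2 ->
     {subset I1 <= I2} -> grade I1 = grade I2 -> D I1 `<=` D I2) /\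
  (forall I : ideal R, is_proper I ->
     [/\ forall n, (1 <= n)%N ->
           \bigcap_(m >= 1) D (ideal_exp I m) `<=` D (ideal_exp I n),
         forall n, (1 <= n)%N ->
           D (ideal_exp I n.+1) `<=` D (ideal_exp I n)
       & forall n, (1 <= n)%N -> D (ideal_exp I n) `<=` D I]).
Proof.
split=> [I1 I2 _ _|I _]; first exact: D_sub.
split=> n n1.
- by move=> r; apply.
- by apply: D_sub; [exact: ideal_exp_subS | rewrite !grade_exp].
- by apply: D_sub; [exact: ideal_exp_sub | rewrite grade_exp].
Qed.
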